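(* Let $w=[x^\top,y^\top,z^\top]^\top$ be the unique solution of the double saddle point problem $\mathfrak{B}w=b$, and let $L\in\mathbb{R}^{k\times l}$. Then the partial unified condition number of $w$ with respect to $L$ is given by $$\mathfrak{K}_{\varphi}(\mathbf{H},b;L)=\left\|\Theta_{\xi_L^{\ddagger}}\,L\,\mathfrak{B}^{-1}\begin{bmatrix}\mathcal{G} & -I_l\end{bmatrix}\begin{bmatrix}\Theta_{\mathrm{vec}(\Psi)} & 0\\ 0&\Theta_{\chi}\end{bmatrix}\right\|_{\tau,\gamma},$$ where $\|\cdot\|_{\tau,\gamma}$ is the matrix norm induced by the vector norms $\|\cdot\|_\tau$ (on the domain) and $\|\cdot\|_\gamma$ (on the codomain).
   Context: Let $A\in\mathbb{R}^{n\times n}$, $B\in\mathbb{R}^{m\times n}$, $C\in\mathbb{R}^{p\times m}$, $D\in\mathbb{R}^{m\times m}$, $E\in\mathbb{R}^{p\times p}$, $l=n+m+p$, $b=[b_1^\top,b_2^\top,b_3^\top]^\top\in\mathbb{R}^{l}$ with $b_1\in\mathbb R^n,b_2\in\mathbb R^m,b_3\in\mathbb R^p$, and $$\mathfrak{B}=\begin{bmatrix} A & B^\top & 0 \\ B & -D & C^\top \\ 0 & C & E \end{bmatrix},$$ which is assumed nonsingular throughout. The double saddle point problem (DSPP) is $\mathfrak{B}w=b$ with $w=[x^\top,y^\top,z^\top]^\top$, $x\in\mathbb R^n$, $y\in\mathbb R^m$, $z\in\mathbb R^p$. Notation: $\mathrm{vec}$ stacks the columns of a matrix; for a tuple of matrices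 $\mathrm{vec}(X_1,\dots,X_r)=[\mathrm{vec}(X_1)^\top,\dots,\mathrm{vec}(X_r)^\top]^\top$. $\otimes$ is the Kronecker product and $\odot$ the entrywise product (applied componentwise to tuples). $\Theta_v$ is the diagonal matrix with diagonal $v$. For a vector or matrix $v$, $v^\ddagger$ has entries $1/v_i$ if $v_i\ne0$ and $1$ if $v_i=0$ (applied to each matrix of a tuple). Write $\mathbf{H}=(A,B,C,D,E)$, $s=n^2+m^2+p^2+nm+mp$, and $$\mathcal{G}=\begin{bmatrix} x^\top\otimes I_n & I_n\otimes y^\top & 0 & 0 & 0 \\ 0 & x^\top\otimes I_m & I_m\otimes z^\top & -y^\top\otimes I_m & 0 \\ 0 & 0 & y^\top\otimes I_p & 0 & z^\top\otimes I_p \end{bmatrix}\in\mathbb{R}^{l\times s}.$$ For $L\in\mathbb{R}^{k\times l}$ ($k\le l$) put $\varphi(\mathbf{H},b)=L[x^\top,y^\top,z^\top]^\top=L\mathfrak{B}^{-1}b$. Let $\xi_L\in\mathbb{R}^k$, $\Psi=(\Psi_A,\Psi_B,\Psi_C,\Psi_D,\Psi_E)$ with $\Psi_A\in\mathbb{R}^{n\times n}$, $\Psi_B\in\mathbb{R}^{m\times n}$, $\Psi_C\in\mathbb{R}^{p\times m}$, $\Psi_D\in\mathbb{R}^{m\times m}$, $\Psi_E\in\mathbb{R}^{p\times p}$, and $\chi\in\mathbb{R}^l$ be parameters, and let $\|\cdot\|_\tau$ and $\|\cdot\|_\gamma$ be vector norms on $\mathbb R^{s+l}$ and $\mathbb R^k$.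 The partial unified condition number of $w$ with respect to $L$ is $$\mathfrak{K}_{\varphi}(\mathbf{H},b;L)=\lim_{\epsilon\to0}\ \sup_{0<\|\mathrm{vec}(\Psi^\ddagger\odot\Delta\mathbf{H},\,\chi^\ddagger\odot\Delta b)\|_\tau\le\epsilon}\frac{\|\xi_L^\ddagger\odot(\varphi(\mathbf{H}+\Delta\mathbf{H},b+\Delta b)-\varphi(\mathbf{H},b))\|_\gamma}{\|\mathrm{vec}(\Psi^\ddagger\odot\Delta\mathbf{H},\,\chi^\ddagger\odot\Delta b)\|_\tau},$$ where $\Delta\mathbf{H}=(\Delta A,\Delta B,\Delta C,\Delta D,\Delta E)$ and $\Delta b$ range over perturbations whose entries are zero wherever the corresponding entry of $\Psi$, respectively $\chi$, is zero.
   Formalization: Added assumption: setting to zero the coordinates where vec(Ψ) or χ vanishes does not increase the τ-norm (automatic if the weights have no zero entries or the norm is absolute); for arbitrary norms with zero weights the formula is false. *)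

(* Defs.v *)
From HB Require Import structures.
From mathcomp Require Import all_boot all_order all_algebra.
From mathcomp Require Import mxtens.
From mathcomp Require Import all_classical all_reals all_analysis.
Import Order.TTheory GRing.Theory Num.Theory.
Import numFieldNormedType.Exports.

Set Implicit Arguments.
Unset Strict Implicit.
Unset Printing Implicit Defensive.

Local Open Scope classical_set_scope.
Local Open Scope ring_scope.

Section Matrices.
Variable R : realType.

(* [mxvec] is row-major, hence the inner transpose: the columns are stacked. *)
Definition vec q r (X : 'M[R]_(q, r)) : 'cV[R]_(r * q) := (mxvec X^T)^T.

Definition hadamard q r (X Y : 'M[R]_(q, r)) : 'M[R]_(q, r) :=
  map2_mx *%R X Y.

Definition ddagger q r (X : 'M[R]_(q, r)) : 'M[R]_(q, r) :=
  map_mx (fun a => if a == 0 then 1 else a^-1) X.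

Definition vanishes_with q r (P X : 'M[R]_(q, r)) : Prop :=
  forall i j, P i j = 0 -> X i j = 0.

(* The Kronecker product [*t] yields [1 * q] (resp. [q * 1]) rows here; these
   dimensions are equal to, but not convertible with, [q]. *)
Definition kron_row_id r q (v : 'rV[R]_r) : 'M[R]_(q, r * q) :=
  castmx (mul1n q, erefl (r * q)%N) (v *t (1%:M : 'M[R]_q)).

Definition kron_id_row q r (v : 'rV[R]_r) : 'M[R]_(q, q * r) :=
  castmx (muln1 q, erefl (q * r)%N) ((1%:M : 'M[R]_q) *t v).

Record is_norm N (f : 'cV[R]_N -> R) : Prop := IsNorm {
  is_norm_eq0 : forall v, f v = 0 -> v = 0 ;
  is_normZ : forall a v, f (a *: v) = `|a| * f v ;
  is_normD : forall u v, f (u + v) <= f u + f v }.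

Definition induced_norm N k (tau : 'cV[R]_N -> R) (gamma : 'cV[R]_k -> R)
    (M : 'M[R]_(k, N)) : R :=
  sup [set gamma (M *m v) / tau v | v in [set v : 'cV[R]_N | v != 0]].

Definition restrict_supp N (d v : 'cV[R]_N) : 'cV[R]_N :=
  \col_i (if d i 0 == 0 then 0 else v i 0).

(* Zeroing the coordinates at which d vanishes does not increase the norm. This
   is automatic if d has no zero entry, and it holds for all d if the norm is
   absolute, e.g., a Hoelder norm. Otherwise the perturbations supported where d
   is nonzero need not attain the induced norm of M *m diag_mx d^T, for which
   all the vectors compete. *)
Definition supp_monotone N (d : 'cV[R]_N) (f : 'cV[R]_N -> R) : Prop :=
  forall v, f (restrict_supp d v) <= f v.

End Matrices.

Section DoubleSaddlePoint.
Variables (R : realType) (n m p : nat).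

(* A tuple (A, B, C, D, E); the product provides componentwise addition. *)
Definition blocks : zmodType :=
  ('M[R]_n * 'M[R]_(m, n) * 'M[R]_(p, m) * 'M[R]_m * 'M[R]_p)%type.

Definition dsp_mx (H : blocks) : 'M[R]_(n + (m + p)) :=
  let: (A, B, C, D, E) := H in
  block_mx A             (row_mx B^T 0)
           (col_mx B 0)  (block_mx (- D) C^T C E).

Definition vec_blocks (H : blocks) :
    'cV[R]_(n * n + (n * m + (m * p + (m * m + p * p)))) :=
  let: (A, B, C, D, E) := H in
  col_mx (vec A) (col_mx (vec B) (col_mx (vec C) (col_mx (vec D) (vec E)))).

Definition hadamard_blocks (H K : blocks) : blocks :=
  let: (A, B, C, D, E) := H in
  let: (A', B', C', D', E') := K in
  (hadamard A A', hadamard B B', hadamard C C', hadamard D D', hadamard E E').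

Definition ddagger_blocks (H : blocks) : blocks :=
  let: (A, B, C, D, E) := H in
  (ddagger A, ddagger B, ddagger C, ddagger D, ddagger E).

Definition vanishes_with_blocks (P H : blocks) : Prop :=
  let: (PA, PB, PC, PD, PE) := P in
  let: (A, B, C, D, E) := H in
  [/\ vanishes_with PA A, vanishes_with PB B, vanishes_with PC C,
      vanishes_with PD D & vanishes_with PE E].

Definition Gmx (x : 'cV[R]_n) (y : 'cV[R]_m) (z : 'cV[R]_p) :
    'M[R]_(n + (m + p), n * n + (n * m + (m * p + (m * m + p * p)))) :=
  col_mx
    (row_mx (kron_row_id n x^T) (row_mx (kron_id_row n y^T) 0))
    (col_mx
      (row_mx 0 (row_mx (kron_row_id m x^T) (row_mx (kron_id_row m z^T)
        (row_mx (kron_row_id m (- y^T)) 0))))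
      (row_mx 0 (row_mx 0 (row_mx (kron_row_id p y^T)
        (row_mx 0 (kron_row_id p z^T)))))).

Variable k : nat.
Variable L : 'M[R]_(k, n + (m + p)).

(* Meaningful when [dsp_mx H] is nonsingular; this holds for all the admissible
   perturbations of a nonsingular matrix of small enough size, the only ones
   that matter for the limit below. *)
Definition phi (H : blocks) (b : 'cV[R]_(n + (m + p))) : 'cV[R]_k :=
  L *m invmx (dsp_mx H) *m b.

Variables (xi : 'cV[R]_k) (Psi : blocks) (chi : 'cV[R]_(n + (m + p))).

(* The column [hadamard (ddagger chi) db] is its own vectorization. *)
Definition scaled_perturbation (dH : blocks) (db : 'cV[R]_(n + (m + p))) :=
  col_mx (vec_blocks (hadamard_blocks (ddagger_blocks Psi) dH))
         (hadamard (ddagger chi) db).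

Variables
  (tau : 'cV[R]_(n * n + (n * m + (m * p + (m * m + p * p))) + (n + (m + p)))
         -> R)
  (gamma : 'cV[R]_k -> R).

Definition perturbations (eps : R) : set (blocks * 'cV[R]_(n + (m + p))) :=
  [set d | [/\ vanishes_with_blocks Psi d.1, vanishes_with chi d.2,
               0 < tau (scaled_perturbation d.1 d.2)
             & tau (scaled_perturbation d.1 d.2) <= eps]].

Variables (H : blocks) (b : 'cV[R]_(n + (m + p))).

Definition error_ratio (d : blocks * 'cV[R]_(n + (m + p))) : R :=
  gamma (hadamard (ddagger xi) (phi (H + d.1) (b + d.2) - phi H b))
  / tau (scaled_perturbation d.1 d.2).

(* The supremum of these nonnegative ratios is taken in [0, +oo]; adjoining 0
   only affects the case without admissible perturbations (Psi = 0, chi = 0),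
   where the supremum of the empty set is 0. *)
Definition error_sup (eps : R) : \bar R :=
  ereal_sup (0%E |` [set (error_ratio d)%:E | d in perturbations eps]).

Definition partial_unified_cond : \bar R :=
  lim (error_sup eps @[eps --> 0^'+]).

Lemma error_sup_is_cvg : cvg (error_sup eps @[eps --> 0^'+]).
Proof.
apply: nondecreasing_at_right_is_cvge.
apply: nearW => x a c _ _ ac.
apply: ereal_sup_le => _ [->|[d [d1 d2 d3 d4] <-]]; first by left.
right; exists d => //.
by split => //; exact: le_trans d4 ac.
Qed.

End DoubleSaddlePoint.

(* Main.v *)
Require Import Defs.
From HB Require Import structures.
From mathcomp Require Import all_boot all_order all_algebra mxtens.
From mathcomp Require Import all_classical all_reals all_analysis.
From mathcomp Require Import ring lra.
Import Order.TTheory GRing.Theory Num.Theory.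
Import numFieldNormedType.Exports.

(** Write Bm for the coefficient matrix, w for the solution, X for the
    perturbation of Bm caused by dH, u for the stacked column of dH and db, and
    d for the stacked column of Psi and chi.

    The quantity whose size is measured in the domain is v = ddagger d * u
    (entrywise). Since u vanishes where d does, u = Theta_d v
    ([hadamard_ddaggerK]), so that v is a faithful coordinate for the
    admissible perturbations.

    Since Bm w = b, the exact increment of the solution is
    (Bm + X)^-1 (db - X w), and X w is linear in dH: it is G vec(dH)
    ([Gmx_vec_blocks]), which is how the Kronecker products enter. Hence phi
    changes by - L (Bm + X)^-1 [G, -I] Theta_d v ([phi_diff]). Replacing
    (Bm + X)^-1 by Bm^-1 costs O(|X|) by a Neumann type estimate
    ([invmx_perturbation]), and |X| = O(tau v) because all norms on a
    finite-dimensional space are equivalent ([mx_norm_le_norm], by compactness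
    of the unit sphere). So with M = Theta_(ddagger xi) L Bm^-1 [G, -I] Theta_d,
    the numerator of the error ratio is gamma (M v) + O((tau v)^2)
    ([error_first_order]), and the ratio itself is gamma (M v) / tau v + O(tau v).

    With K the induced norm of M, the supremum over tau v <= eps is therefore at
    most K + O(eps). It is also at least K - O(eps): the quotient
    gamma (M v) / tau v does not change when v is scaled, so small admissible v
    lose nothing, and a v that is not supported where d is nonzero may be
    restricted to that support, which leaves M v unchanged and, by hypothesis on
    tau, does not increase tau v. Letting eps tend to 0 gives the formula. *)

Local Open Scope ring_scope.
Set Implicit Arguments.
Unset Strict Implicit.
Unset Printing Implicit Defensive.

(** * Kronecker products acting on vectorized matrices *)

Section Kron.

Lemma index_allpairs (S T : eqType) (s : seq S) (t : seq T) (x : S) (y : T) :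
  x \in s -> y \in t ->
  index (x, y) [seq (a, b) | a <- s, b <- t]
  = (index x s * size t + index y t)%N.
Proof.
elim: s => [//|a s IHs]; rewrite inE => xs yt.
rewrite allpairs_cons index_cat /=.
case: (eqVneq a x) xs => [-> _|ax] /=.
  rewrite mem_map ?yt; last by move=> u v [].
  by rewrite mul0n index_map // => u v [].
move=> xs.
have /negbTE-> : (x, y) \notin [seq (a, b) | b <- t].
  by apply/mapP => -[b _ [ax' _]]; rewrite ax' eqxx in ax.
by rewrite size_map IHs // mulSn addnA.
Qed.

(** Vectorization indexes pairs through the enumeration of a product type, and
    the Kronecker product through Euclidean division. Both orders are row-major,
    so the two numberings coincide. *)
Lemma mxvec_indexE q r (i : 'I_q) (j : 'I_r) :
  mxvec_index i j = mxtens_index (i, j).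
Proof.
apply: val_inj => /=.
have -> : enum_rank (i, j) = index (i, j) (enum {: 'I_q * 'I_r}) :> nat.
  rewrite -[X in index X _](nth_enum_rank (i, j)).
  by rewrite index_uniq ?enum_uniq -?cardE.
rewrite enumT unlock /=.
by rewrite index_allpairs ?mem_enum // !index_enum_ord size_enum_ord.
Qed.

Variable R : realType.

Lemma vecE q r (X : 'M[R]_(q, r)) i j k : vec X (mxtens_index (j, i)) k = X i j.
Proof. by rewrite -mxvec_indexE ord1 mxE mxvecE mxE. Qed.

Lemma sum_mxtens_index q r (F : 'I_(q * r) -> R) :
  \sum_k F k = \sum_i \sum_j F (mxtens_index (i, j)).
Proof.
rewrite pair_bigA; apply: reindex => /=.
exists (@mxtens_unindex q r) => k _; last exact: mxtens_unindexK.
by rewrite -surjective_pairing mxtens_indexK.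
Qed.

Lemma kron_row_id_vec q r (v : 'cV[R]_r) (X : 'M[R]_(q, r)) :
  kron_row_id q v^T *m vec X = X *m v.
Proof.
apply/matrixP => i j; rewrite ord1 {j} !mxE sum_mxtens_index.
apply: eq_bigr => j _; rewrite (bigD1 i) //= big1 => [|i' i'i].
  rewrite vecE castmxE.
  have -> : cast_ord (esym (mul1n q)) i = mxtens_index (ord0, i).
    exact: val_inj.
  by rewrite cast_ord_id tensmxE !mxE eqxx mulr1 addr0 mulrC.
have e : cast_ord (esym (mul1n q)) i = mxtens_index (ord0, i).
  exact: val_inj.
by rewrite castmxE e cast_ord_id tensmxE !mxE eq_sym (negbTE i'i) mulr0 mul0r.
Qed.

Lemma kron_id_row_vec q r (v : 'cV[R]_r) (X : 'M[R]_(r, q)) :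
  kron_id_row q v^T *m vec X = X^T *m v.
Proof.
apply/matrixP => i j; rewrite ord1 {j} !mxE sum_mxtens_index.
have e : cast_ord (esym (muln1 q)) i = mxtens_index (i, ord0).
  by apply: val_inj; rewrite /= muln1 addn0.
rewrite (bigD1 i) //= [X in _ + X]big1 => [|i' i'i]; last first.
  apply: big1 => j _.
  by rewrite castmxE e cast_ord_id tensmxE !mxE eq_sym (negbTE i'i) !mul0r.
rewrite addr0; apply: eq_bigr => j _; rewrite vecE castmxE e cast_ord_id.
by rewrite tensmxE !mxE eqxx mul1r mulrC.
Qed.

(** The reason for the shape of G: the product of the perturbed coefficients
    with a fixed vector is linear in the coefficients, and G is its matrix in
    vectorized coordinates. *)
Lemma Gmx_vec_blocks n m p (x : 'cV[R]_n) (y : 'cV[R]_m) (z : 'cV[R]_p)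
    (dH : blocks R n m p) :
  Gmx x y z *m vec_blocks dH = dsp_mx dH *m col_mx x (col_mx y z).
Proof.
case: dH => [[[[A B] C] D] E]; rewrite /Gmx /vec_blocks /dsp_mx.
rewrite mul_block_col !mul_col_mx !mul_row_col.
have -> : - y^T = (- y)^T by apply/matrixP => i j; rewrite !mxE.
rewrite !kron_row_id_vec !kron_id_row_vec !mul0mx.
by rewrite mulmxN mulNmx add_col_mx !(addr0, add0r) [- _ + _]addrC.
Qed.
End Kron.

(** * The entrywise maximum norm and perturbed inverses *)

Section MaxNorm.
Variable R : realType.

Lemma mx_entry_le q r (M : 'M[R]_(q, r)) i j : `|M i j| <= `|M|.
Proof.
by rewrite [leRHS]/Num.Def.normr/= mx_normrE; exact: (le_bigmax _ _ (i, j)).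
Qed.

Lemma mx_norm_le q r (M : 'M[R]_(q, r)) (c : R) :
  0 <= c -> (forall i j, `|M i j| <= c) -> `|M| <= c.
Proof.
by move=> c0 Mc; rewrite [leLHS]/Num.Def.normr/= mx_normrE bigmax_le.
Qed.

Lemma mx_norm_mulmx q r s (A : 'M[R]_(q, r)) (B : 'M[R]_(r, s)) :
  `|A *m B| <= r%:R * (`|A| * `|B|).
Proof.
apply: mx_norm_le => [|i j]; first by rewrite !mulr_ge0.
rewrite mxE (le_trans (ler_norm_sum _ _ _)) //.
rewrite -[r in r%:R]card_ord mulr_natl -sumr_const ler_sum // => t _.
by rewrite normrM ler_pM // mx_entry_le.
Qed.

Lemma mx_norm_tr q r (M : 'M[R]_(q, r)) : `|M^T| = `|M|.
Proof.
by apply/eqP; rewrite eq_le !mx_norm_le // => i j; rewrite ?mxE ?mx_entry_le //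
  -[M]trmxK mxE trmxK mx_entry_le.
Qed.

Lemma mx_norm_col_mx q1 q2 r (A : 'M[R]_(q1, r)) (B : 'M[R]_(q2, r)) :
  `|col_mx A B| = Num.max `|A| `|B|.
Proof.
apply/eqP; rewrite eq_le ge_max; apply/and3P; split; apply: mx_norm_le => //.
- move=> i j; rewrite mxE le_max; case: splitP => t _.
    by rewrite mx_entry_le.
  by rewrite mx_entry_le orbT.
- by move=> i j; rewrite -(col_mxEu A B) mx_entry_le.
- by move=> i j; rewrite -(col_mxEd A B) mx_entry_le.
Qed.

Lemma mx_norm_row_mx q r1 r2 (A : 'M[R]_(q, r1)) (B : 'M[R]_(q, r2)) :
  `|row_mx A B| = Num.max `|A| `|B|.
Proof. by rewrite -mx_norm_tr tr_row_mx mx_norm_col_mx !mx_norm_tr. Qed.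

(** For small X, the map V |-> V X A^-1 is a contraction of ratio 1/2. Hence
    A + X has no kernel, and Y = (A + X)^-1, which satisfies
    Y - A^-1 = - Y X A^-1, is bounded by 2 |A^-1|. The same identity then gives
    the Lipschitz estimate. *)
Lemma invmx_perturbation l (A : 'M[R]_l) : A \in unitmx ->
  exists2 c : R, 0 < c & exists2 delta : R, 0 < delta &
    forall X, `|X| <= delta -> A + X \in unitmx /\
      `|invmx (A + X) - invmx A| <= c * `|X|.
Proof.
move=> Au; set a := `|invmx A|; set q : R := l%:R.
have a0 : 0 <= a by exact: normr_ge0.
have q0 : 0 <= q by exact: ler0n.
have qqa : 0 <= q * q * a by rewrite !mulr_ge0.
exists (2 * (q * q * a * a) + 1).
  by rewrite ltr_wpDl // !mulr_ge0.
(* Each of the two products in V X A^-1 contributes a factor l; the summand 1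
   keeps the denominator nonzero for l = 0. *)
exists ((2 * (q * q * a + 1))^-1).
  by rewrite invr_gt0 mulr_gt0 // ltr_wpDl.
move=> X Xsmall.
have half : q * q * a * `|X| <= 2^-1.
  apply: (@le_trans _ _ ((q * q * a + 1) * (2 * (q * q * a + 1))^-1)).
    by rewrite ler_pM // lerDl.
  have nz : q * q * a + 1 != 0 by rewrite gt_eqF // ltr_wpDl.
  by rewrite invfM mulrCA mulfV // mulr1.
have shrink s (V : 'M[R]_(s, l)) : `|V *m X *m invmx A| <= 2^-1 * `|V|.
  apply: le_trans (mx_norm_mulmx _ _) _.
  have := mx_norm_mulmx V X; rewrite -/q -/a.
  set y := `|V *m X| => yle.
  apply: (@le_trans _ _ (q * (q * (`|V| * `|X|) * a))).
    by rewrite ler_wpM2l // ler_wpM2r.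
  have -> : q * (q * (`|V| * `|X|) * a) = q * q * a * `|X| * `|V| by ring.
  by rewrite ler_wpM2r.
have u : A + X \in unitmx.
  rewrite -row_free_unit; apply: inj_row_free => v.
  rewrite mulmxDr => /(congr1 (mulmxr (invmx A))) /=.
  rewrite mul0mx mulmxDl mulmxK // => /eqP; rewrite addr_eq0 => /eqP vE.
  have := shrink _ v; rewrite -normrN -vE => le2.
  by apply/eqP; rewrite -normr_eq0; apply/eqP; have := normr_ge0 v; lra.
split=> //; set Y := invmx (A + X).
have YE : Y - invmx A = - (Y *m X *m invmx A).
  have /(congr1 (mulmxr (invmx A))) /= : Y *m (A + X) = 1%:M by rewrite mulVmx.
  rewrite mulmxDr mulmxDl mulmxK // mul1mx => e.
  by rewrite -[X in _ - X]e opprD addrA subrr add0r.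
have Yle : `|Y| <= 2 * a.
  have := shrink _ Y; rewrite -normrN -YE => le2.
  have := ler_normD (Y - invmx A) (invmx A); rewrite subrK -/a; lra.
rewrite YE normrN; apply: le_trans (mx_norm_mulmx _ _) _.
rewrite -/q -/a.
apply: (@le_trans _ _ (q * (q * (2 * a * `|X|) * a))).
  rewrite ler_wpM2l // ler_wpM2r //.
  apply: le_trans (mx_norm_mulmx _ _) _.
  by rewrite -/q ler_wpM2l // ler_wpM2r.
have := normr_ge0 X; set t := `|X| => t0.
have -> : q * (q * (2 * a * t) * a) = 2 * (q * q * a * a) * t by ring.
by rewrite ler_wpM2r // lerDl.
Qed.

End MaxNorm.

(** * Norms on a finite-dimensional space and induced norms *)

Section Norms.
Variable R : realType.

Section OneNorm.
Context {N : nat} {f : 'cV[R]_N -> R}.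
Hypothesis fnorm : is_norm f.

Lemma norm_at0 : f 0 = 0.
Proof. by rewrite -(scale0r 0) (is_normZ fnorm) normr0 mul0r. Qed.

Lemma norm_opp v : f (- v) = f v.
Proof. by rewrite -scaleN1r (is_normZ fnorm) normrN1 mul1r. Qed.

Lemma norm_nonneg v : 0 <= f v.
Proof.
have := is_normD fnorm v (- v); rewrite subrr norm_at0 norm_opp; lra.
Qed.

Lemma norm_pos v : v != 0 -> 0 < f v.
Proof.
move=> v0; rewrite lt_def norm_nonneg andbT.
by apply: contra_neq v0 => /(is_norm_eq0 fnorm).
Qed.

Lemma norm_dist u v : `|f u - f v| <= f (u - v).
Proof.
have := is_normD fnorm (u - v) v; rewrite subrK => ?.
have := is_normD fnorm (v - u) u; rewrite subrK -[v - u]opprB norm_opp => ?.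
by rewrite ler_norml; apply/andP; split; lra.
Qed.

(** Expand v in the canonical basis. *)
Lemma norm_le_mx_norm : exists2 c, 0 < c & forall v, f v <= c * `|v|.
Proof.
exists (1 + \sum_i f (delta_mx i 0)).
  by rewrite ltr_wpDr // sumr_ge0 // => i _; exact: norm_nonneg.
move=> v; rewrite mulrDl mul1r ler_wpDl //.
rewrite {1}[v]matrix_sum_delta.
under eq_bigr do rewrite big_ord1.
rewrite mulr_suml.
elim/big_rec2 : _ => [|i s w _ sw]; first by rewrite norm_at0.
apply: le_trans (is_normD fnorm _ _) _; apply: lerD => //.
by rewrite (is_normZ fnorm) mulrC ler_wpM2l ?norm_nonneg ?mx_entry_le.
Qed.

Lemma norm_tr_continuous : continuous (fun u : 'rV[R]_N => f u^T).
Proof.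
have [c c0 fc] := norm_le_mx_norm.
move=> u; apply/(@cvgrPdist_lt _ _ _ (nbhs u) (nbhs_filter u)) => e e0.
apply/(@nbhs_normP R 'rV[R]_N); exists (e / c); first by rewrite /= divr_gt0.
move=> w /= uw; apply: le_lt_trans (norm_dist _ _) _.
apply: le_lt_trans (fc _) _.
by rewrite -linearB mx_norm_tr mulrC -ltr_pdivlMr.
Qed.

(** The other half of the equivalence of norms: the norm attains a positive
    minimum on the unit sphere of the maximum norm, which is compact. *)
Lemma mx_norm_le_norm : exists2 c, 0 < c & forall v, `|v| <= c * f v.
Proof.
pose S : set 'rV[R]_N := [set u | `|u| = 1]%classic.
have unit_S (v : 'cV[R]_N) : v != 0 -> S (`|v|^-1 *: v^T).
  move=> v0; rewrite /S /= normrZ mx_norm_tr normfV normr_id mulVf //.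
  by rewrite normr_eq0.
have [S0|S0] := pselect (S !=set0)%classic; last first.
  (* The sphere is empty only in dimension 0. *)
  exists 1 => // v; have [->|/unit_S Sv] := eqVneq v 0.
    by rewrite normr0 norm_at0 mulr0.
  by case: S0; eexists; exact: Sv.
have Sc : compact S.
  apply: bounded_closed_compact.
    by exists 1; split => // x x1 u /= ->; rewrite ltW.
  have /continuous_closedP normC := @norm_continuous R 'rV[R]_N.
  by apply: (normC [set 1]%classic); exact: closed_eq.
have [u uS umin] := compact_EVT_min S0 Sc
  (continuous_subspaceT norm_tr_continuous).
have u1 : `|u| = 1 by move: uS; rewrite inE.
have fu : 0 < f u^T.
  apply: norm_pos; apply: contra_eq_neq u1 => u0.
  by rewrite -mx_norm_tr u0 normr0 eq_sym oner_neq0.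
exists (f u^T)^-1; first by rewrite invr_gt0.
move=> v; have [->|v0] := eqVneq v 0.
  by rewrite normr0 norm_at0 mulr0.
have := umin (`|v|^-1 *: v^T); rewrite inE => /(_ (unit_S v v0)).
rewrite linearZ /= trmxK (is_normZ fnorm) normfV normr_id.
have vpos : 0 < `|v| by rewrite normr_gt0.
by rewrite -ler_pdivrMl ?invr_gt0 // invrK ler_pdivlMl // mulrC.
Qed.

End OneNorm.

Section InducedNorm.
Context {N k : nat} {tau : 'cV[R]_N -> R} {gamma : 'cV[R]_k -> R}.
Hypotheses (htau : is_norm tau) (hgamma : is_norm gamma).

Lemma norm_mulmx_le : exists2 c, 0 < c &
  forall (M : 'M[R]_(k, N)) v, gamma (M *m v) <= c * (`|M| * tau v).
Proof.
have [c1 c10 gc] := norm_le_mx_norm hgamma.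
have [c2 c20 tc] := mx_norm_le_norm htau.
exists (c1 * (N%:R + 1) * c2); first by rewrite !mulr_gt0 // ltr_wpDl.
move=> M v; apply: le_trans (gc _) _; rewrite -!mulrA ler_pM2l //.
apply: le_trans (mx_norm_mulmx _ _) _.
rewrite ler_pM //; first by rewrite lerDl.
by rewrite mulrCA ler_wpM2l.
Qed.

Variable M : 'M[R]_(k, N).

Lemma induced_norm_le c : 0 <= c ->
  (forall v, gamma (M *m v) <= c * tau v) -> induced_norm tau gamma M <= c.
Proof.
move=> c0 Mc; rewrite /induced_norm; set S := (X in sup X).
have [->|/set0P S0] := eqVneq S set0; first by rewrite sup0.
apply: ge_sup => // _ [v v0 <-].
by rewrite ler_pdivrMr ?Mc // norm_pos.
Qed.

(** The set defining the induced norm is bounded, so that its supremum is a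
    genuine upper bound and not a default value. *)
Lemma le_induced_norm v : gamma (M *m v) <= induced_norm tau gamma M * tau v.
Proof.
have [->|v0] := eqVneq v 0.
  by rewrite mulmx0 (norm_at0 htau) (norm_at0 hgamma) mulr0.
rewrite -ler_pdivrMr ?norm_pos //; apply: ub_le_sup; last by exists v.
have [c c0 Mc] := norm_mulmx_le.
exists (c * `|M|) => _ [u u0 <-].
by rewrite ler_pdivrMr ?norm_pos // -mulrA Mc.
Qed.

Lemma induced_norm_ge0 : 0 <= induced_norm tau gamma M.
Proof.
rewrite /induced_norm; set S := (X in sup X).
have [->|/set0P[_ [v v0 _]]] := eqVneq S set0; first by rewrite sup0.
rewrite -(pmulr_lge0 _ (norm_pos htau v0)).
exact: le_trans (norm_nonneg hgamma _) (le_induced_norm v).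
Qed.

End InducedNorm.
End Norms.

(** * Vectorization, entrywise scaling and supports *)

Section Scaling.
Variable R : realType.

Lemma diag_mx_hadamard N (d v : 'cV[R]_N) : diag_mx d^T *m v = hadamard d v.
Proof. by apply/matrixP => i j; rewrite mul_diag_mx !mxE ord1. Qed.

(** At the zeros of d the entry of ddagger d is 1 and multiplying by d kills it,
    which is harmless since v vanishes there. *)
Lemma hadamard_ddaggerK N (d v : 'cV[R]_N) :
  vanishes_with d v -> hadamard d (hadamard (ddagger d) v) = v.
Proof.
move=> dv; apply/matrixP => i j; rewrite !mxE.
by case: eqVneq => [di0|di]; [rewrite dv // !mulr0|rewrite mulVKf].
Qed.

Lemma hadamard_ddagger_restrict N (d v : 'cV[R]_N) :
  hadamard (ddagger d) (hadamard d v) = restrict_supp d v.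
Proof.
apply/matrixP => i j; rewrite !mxE ord1.
by case: eqVneq => [->|di]; [rewrite mul0r mulr0|rewrite mulKf].
Qed.

Lemma hadamard_restrict N (d v : 'cV[R]_N) :
  hadamard d (restrict_supp d v) = hadamard d v.
Proof.
apply/matrixP => i j; rewrite !mxE ord1.
by case: eqVneq => // ->; rewrite !mul0r.
Qed.

Lemma vanishes_with_hadamard N (d v : 'cV[R]_N) :
  vanishes_with d (hadamard d v).
Proof. by move=> i j di; rewrite !mxE di mul0r. Qed.

Lemma vec_hadamard q r (X Y : 'M[R]_(q, r)) :
  vec (hadamard X Y) = hadamard (vec X) (vec Y).
Proof.
apply/matrixP => k j; case: (mxtens_indexP k) => a i.
by rewrite [RHS]mxE !vecE mxE.
Qed.

Lemma vec_ddagger q r (X : 'M[R]_(q, r)) : vec (ddagger X) = ddagger (vec X).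
Proof.
apply/matrixP => k j; case: (mxtens_indexP k) => a i.
by rewrite [RHS]mxE !vecE mxE.
Qed.

Lemma vanishes_with_vec q r (P X : 'M[R]_(q, r)) :
  vanishes_with (vec P) (vec X) <-> vanishes_with P X.
Proof.
split=> PX i j; first by have := PX (mxtens_index (j, i)) 0; rewrite !vecE.
by case: (mxtens_indexP i) => a {}i; rewrite !vecE; exact: PX.
Qed.

Lemma vec_surj q r (u : 'cV[R]_(r * q)) : exists X : 'M[R]_(q, r), vec X = u.
Proof. by exists (vec_mx u^T)^T; rewrite /vec trmxK vec_mxK trmxK. Qed.

Lemma hadamard_col_mx q1 q2 (u1 v1 : 'cV[R]_q1) (u2 v2 : 'cV[R]_q2) :
  hadamard (col_mx u1 u2) (col_mx v1 v2)
  = col_mx (hadamard u1 v1) (hadamard u2 v2).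
Proof.
by apply/matrixP => i j; rewrite !mxE; case: splitP => t _; rewrite mxE.
Qed.

Lemma ddagger_col_mx q1 q2 (u1 : 'cV[R]_q1) (u2 : 'cV[R]_q2) :
  ddagger (col_mx u1 u2) = col_mx (ddagger u1) (ddagger u2).
Proof. exact: map_col_mx. Qed.

Lemma vanishes_with_col_mx q1 q2 (u1 v1 : 'cV[R]_q1) (u2 v2 : 'cV[R]_q2) :
  vanishes_with (col_mx u1 u2) (col_mx v1 v2) <->
  vanishes_with u1 v1 /\ vanishes_with u2 v2.
Proof.
split=> [uv|[uv1 uv2] i j].
  split=> i j; first by have := uv (lshift q2 i) j; rewrite !col_mxEu.
  by have := uv (rshift q1 i) j; rewrite !col_mxEd.
by rewrite !mxE; case: splitP => t _; [exact: uv1|exact: uv2].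
Qed.

Variables n m p : nat.
Implicit Types P Q dH : blocks R n m p.

Lemma vec_blocks_hadamard P Q :
  vec_blocks (hadamard_blocks P Q) = hadamard (vec_blocks P) (vec_blocks Q).
Proof.
case: P Q => [[[[? ?] ?] ?] ?] [[[[? ?] ?] ?] ?] /=.
by rewrite !hadamard_col_mx !vec_hadamard.
Qed.

Lemma vec_blocks_ddagger P :
  vec_blocks (ddagger_blocks P) = ddagger (vec_blocks P).
Proof.
by case: P => [[[[? ?] ?] ?] ?] /=; rewrite !ddagger_col_mx !vec_ddagger.
Qed.

Lemma vanishes_with_vec_blocks P Q :
  vanishes_with (vec_blocks P) (vec_blocks Q) <-> vanishes_with_blocks P Q.
Proof.
case: P Q => [[[[? ?] ?] ?] ?] [[[[? ?] ?] ?] ?] /=.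
rewrite !vanishes_with_col_mx !vanishes_with_vec.
by split=> [[? [? [? [? ?]]]]|[]].
Qed.

(** Together with [scaled_perturbationE], this allows one to quantify over
    vectors instead of tuples of matrices. *)
Lemma vec_blocks_surj u : exists dH, vec_blocks dH = u.
Proof.
have [A eA] := vec_surj (usubmx u).
have [B eB] := vec_surj (usubmx (dsubmx u)).
have [C eC] := vec_surj (usubmx (dsubmx (dsubmx u))).
have [D eD] := vec_surj (usubmx (dsubmx (dsubmx (dsubmx u)))).
have [E eE] := vec_surj (dsubmx (dsubmx (dsubmx (dsubmx u)))).
by exists (A, B, C, D, E); rewrite /= eA eB eC eD eE !vsubmxK.
Qed.

Lemma dsp_mxD P Q : dsp_mx (P + Q) = dsp_mx P + dsp_mx Q.
Proof.
case: P Q => [[[[A B] C] D] E] [[[[A' B'] C'] D'] E'] /=.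
rewrite !add_block_mx add_row_mx add_col_mx !addr0 opprD.
by rewrite !linearD.
Qed.

Lemma mx_norm_vec q r (X : 'M[R]_(q, r)) : `|vec X| = `|X|.
Proof.
apply/eqP; rewrite eq_le; apply/andP; split; apply: mx_norm_le => // i j.
  by case: (mxtens_indexP i) => a {}i; rewrite vecE mx_entry_le.
by rewrite -(vecE X i j 0) mx_entry_le.
Qed.

Lemma mx_norm_dsp_mx dH : `|dsp_mx dH| <= `|vec_blocks dH|.
Proof.
case: dH => [[[[A B] C] D] E]; rewrite /dsp_mx /vec_blocks /block_mx.
rewrite !(mx_norm_col_mx, mx_norm_row_mx) !mx_norm_vec !mx_norm_tr normrN.
by rewrite !normr0 !ge_max !le_max !lexx !normr_ge0 !orbT.
Qed.

End Scaling.

(** * First-order expansion of the error *)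

Section Perturbation.
Variables (R : realType) (n m p k : nat).
Variables (H : blocks R n m p) (b : 'cV[R]_(n + (m + p))).
Variables (x : 'cV[R]_n) (y : 'cV[R]_m) (z : 'cV[R]_p).
Hypotheses (hB : dsp_mx H \in unitmx)
  (hw : dsp_mx H *m col_mx x (col_mx y z) = b).
Variable L : 'M[R]_(k, n + (m + p)).

Local Notation w := (col_mx x (col_mx y z)).
Local Notation J := (row_mx (Gmx x y z) (- 1%:M)).

(** Both solutions are compared through w = (Bm + X)^-1 (Bm w + X w), where
    Bm w = b, so the increment is (Bm + X)^-1 (db - X w). *)
Lemma phi_diff dH db : dsp_mx H + dsp_mx dH \in unitmx ->
  phi L (H + dH) (b + db) - phi L H b
  = - (L *m invmx (dsp_mx H + dsp_mx dH) *m J *m col_mx (vec_blocks dH) db).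
Proof.
move=> u; rewrite /phi dsp_mxD -!mulmxA -mulmxBr -[RHS]mulmxN; congr (_ *m _).
rewrite mul_row_col Gmx_vec_blocks mulNmx mul1mx -hw mulKmx //.
rewrite -[X in _ - X](mulKmx u) -mulmxBr -[RHS]mulmxN; congr (_ *m _).
by rewrite mulmxDl opprB opprD addrACA subrr add0r.
Qed.

Variables (xi : 'cV[R]_k) (Psi : blocks R n m p) (chi : 'cV[R]_(n + (m + p))).
Variables
  (tau : 'cV[R]_(n * n + (n * m + (m * p + (m * m + p * p))) + (n + (m + p)))
         -> R)
  (gamma : 'cV[R]_k -> R).
Hypotheses (htau : is_norm tau) (hgamma : is_norm gamma).

Local Notation d := (col_mx (vec_blocks Psi) chi).
Local Notation M := (diag_mx (ddagger xi)^T *m L *m invmx (dsp_mx H) *m J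
  *m diag_mx d^T).

Lemma scaled_perturbationE dH db :
  scaled_perturbation Psi chi dH db
  = hadamard (ddagger d) (col_mx (vec_blocks dH) db).
Proof.
by rewrite ddagger_col_mx hadamard_col_mx -vec_blocks_ddagger
  -vec_blocks_hadamard.
Qed.

(** Take Theta_d v as the perturbation. *)
Lemma scaled_perturbation_surj v : exists dH db,
  [/\ vanishes_with_blocks Psi dH, vanishes_with chi db &
      scaled_perturbation Psi chi dH db = restrict_supp d v].
Proof.
have [dH edH] := vec_blocks_surj (hadamard (vec_blocks Psi) (usubmx v)).
have e : col_mx (vec_blocks dH) (hadamard chi (dsubmx v)) = hadamard d v.
  by rewrite edH -hadamard_col_mx vsubmxK.
exists dH, (hadamard chi (dsubmx v)); split=> //.
- by rewrite -vanishes_with_vec_blocks edH; exact: vanishes_with_hadamard.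
- exact: vanishes_with_hadamard.
- by rewrite scaled_perturbationE e hadamard_ddagger_restrict.
Qed.

(** Only the inverse matrix differs between the exact increment and the linear
    one. Its variation is O(|X|) = O(tau v), and it is multiplied by a vector of
    size O(tau v), so the error is quadratic. *)
Lemma error_first_order : exists2 C, 0 < C & exists2 delta, 0 < delta &
  forall dH db, vanishes_with_blocks Psi dH -> vanishes_with chi db ->
    let v := scaled_perturbation Psi chi dH db in
    tau v <= delta ->
    `|gamma (hadamard (ddagger xi) (phi L (H + dH) (b + db) - phi L H b))
      - gamma (M *m v)| <= C * tau v * tau v.
Proof.
have [c1 c10 [delta delta0 inv_close]] := invmx_perturbation hB.
have [c2 c20 c2P] := norm_mulmx_le htau hgamma.
have [c3 c30 c3P] := mx_norm_le_norm htau.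
set l : R := (n + (m + p))%:R.
set t := `|diag_mx (ddagger xi)^T *m L|.
set g := `|J *m diag_mx d^T|.
set s : R := (n * n + (n * m + (m * p + (m * m + p * p))) + (n + (m + p)))%:R.
pose c4 := s * (`|diag_mx d^T| * c3) + 1.
have l0 : 0 <= l by exact: ler0n.
have s0 : 0 <= s by exact: ler0n.
have t0 : 0 <= t by exact: normr_ge0.
have g0 : 0 <= g by exact: normr_ge0.
have c40 : 0 < c4 by rewrite ltr_wpDl // !mulr_ge0 // ltW.
have [c1' c2' c4'] := And3 (ltW c10) (ltW c20) (ltW c40).
exists (c2 * (l * (l * (t * (c1 * c4)) * g)) + 1).
  by rewrite ltr_wpDl // !mulr_ge0.
exists (delta / c4); first by rewrite divr_gt0.
move=> dH db PdH cdb v tauv.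
have vE : col_mx (vec_blocks dH) db = diag_mx d^T *m v.
  rewrite diag_mx_hadamard /v scaled_perturbationE hadamard_ddaggerK //.
  by apply/vanishes_with_col_mx; split=> //; apply/vanishes_with_vec_blocks.
have v0 := norm_nonneg htau v.
have Xv : `|dsp_mx dH| <= c4 * tau v.
  apply: le_trans (mx_norm_dsp_mx _) _.
  apply: (@le_trans _ _ `|col_mx (vec_blocks dH) db|).
    by rewrite mx_norm_col_mx le_max lexx.
  rewrite vE; apply: le_trans (mx_norm_mulmx _ _) _; rewrite -/s.
  apply: (@le_trans _ _ (s * (`|diag_mx d^T| * (c3 * tau v)))).
    by rewrite !ler_wpM2l.
  by rewrite !mulrA ler_wpM2r // /c4 mulrA lerDl.
have Xdelta : `|dsp_mx dH| <= delta.
  by apply: le_trans Xv _; rewrite mulrC -ler_pdivlMr.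
have [u inv_diff] := inv_close _ Xdelta.
rewrite phi_diff // -diag_mx_hadamard mulmxN (norm_opp hgamma) vE.
apply: le_trans (norm_dist hgamma _ _) _.
set Y := invmx (dsp_mx H + dsp_mx dH) in inv_diff *.
(* Here Y is the perturbed inverse; the difference factors through
   Y - Bm^-1. *)
have -> : diag_mx (ddagger xi)^T *m (L *m Y *m J *m (diag_mx d^T *m v))
    - M *m v
  = (diag_mx (ddagger xi)^T *m L *m (Y - invmx (dsp_mx H))
     *m (J *m diag_mx d^T)) *m v.
  by rewrite mulmxBr !mulmxBl !mulmxA.
apply: le_trans (c2P _ _) _.
rewrite [leLHS]mulrA ler_wpM2r //.
apply: (@le_trans _ _ (c2 * (l * (l * (t * (c1 * c4)) * g)) * tau v));
  last first.
  by rewrite ler_wpM2r // lerDl.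
rewrite -mulrA ler_pM2l //.
apply: le_trans (mx_norm_mulmx _ _) _; rewrite -/g -/l.
have -> : l * (l * (t * (c1 * c4)) * g) * tau v
  = l * (l * (t * (c1 * (c4 * tau v))) * g) by ring.
rewrite ler_wpM2l // ler_wpM2r //.
apply: le_trans (mx_norm_mulmx _ _) _; rewrite -/t -/l.
rewrite ler_wpM2l // ler_wpM2l //.
by apply: le_trans inv_diff _; rewrite ler_wpM2l // ltW.
Qed.

Hypothesis htau_supp : supp_monotone d tau.

(** The upper bound is the first-order estimate for each perturbation. For the
    lower bound, every direction is restricted to the support of d and then
    scaled to tau-norm eps, so that it competes in the supremum. *)
Lemma error_sup_first_order : exists2 C, 0 < C & exists2 delta, 0 < delta &
  forall eps, 0 < eps <= delta ->
  ((induced_norm tau gamma M - C * eps)%:E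
     <= error_sup L xi Psi chi tau gamma H b eps
     <= (induced_norm tau gamma M + C * eps)%:E)%E.
Proof.
have [C C0 [delta delta0 close]] := error_first_order.
exists C => //; exists delta => // eps /andP[eps0 epsd].
set K := induced_norm _ _ _.
have K0 : 0 <= K by exact: induced_norm_ge0.
have Ceps : 0 <= C * eps by rewrite mulr_ge0 // ltW.
have upper : (error_sup L xi Psi chi tau gamma H b eps <= (K + C * eps)%:E)%E.
  (* The first case is the adjoined 0. *)
  apply: ge_ereal_sup => _ [->|[[dH db] [/= PdH cdb v0 veps] <-]].
    by rewrite lee_fin addr_ge0.
  rewrite lee_fin /error_ratio /= ler_pdivrMr //.
  have := close dH db PdH cdb (le_trans veps epsd).
  have := le_induced_norm htau hgamma M (scaled_perturbation Psi chi dH db).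
  rewrite -/K /=; set v := scaled_perturbation _ _ _ _ in v0 veps *.
  move=> Mv; rewrite ler_distl => /andP[_ ub]; apply: le_trans ub _.
  by rewrite mulrDl lerD // ler_wpM2r ?(ltW v0) // ler_wpM2l // ltW.
rewrite upper andbT.
have lower0 : (0 <= error_sup L xi Psi chi tau gamma H b eps)%E.
  by apply: ereal_sup_ubound; left.
move: upper lower0; case Er : (error_sup _ _ _ _ _ _ _ _ _) => [r| |] //.
rewrite !lee_fin => _ r0; rewrite lerBlDr.
apply: induced_norm_le => //; first by rewrite addr_ge0.
move=> v0; set v := restrict_supp d v0.
have Mv : M *m v0 = M *m v.
  by rewrite -![_ *m diag_mx _ *m _]mulmxA !diag_mx_hadamard hadamard_restrict.
rewrite Mv; apply: (@le_trans _ _ ((r + C * eps) * tau v)); last first.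
  by rewrite ler_wpM2l ?addr_ge0 //; exact: htau_supp.
have [->|vn0] := eqVneq v 0.
  by rewrite mulmx0 (norm_at0 htau) (norm_at0 hgamma) mulr0.
have tv := norm_pos htau vn0.
(* The largest admissible multiple of v. *)
pose a := eps / tau v; have a0 : 0 < a by rewrite divr_gt0.
have [dH [db [PdH cdb uE]]] := scaled_perturbation_surj (a *: v0).
have {}uE : scaled_perturbation Psi chi dH db = a *: v.
  rewrite uE; apply/matrixP => i j; rewrite !mxE.
  by case: eqP; rewrite ?mulr0.
have tu : tau (a *: v) = eps.
  by rewrite (is_normZ htau) gtr0_norm // /a divfK // gt_eqF.
have := close dH db PdH cdb; rewrite /= uE tu => /(_ epsd).
have : ((error_ratio L xi Psi chi tau gamma H b (dH, db))%:E <= r%:E)%E.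
  rewrite -Er; apply: ereal_sup_ubound; right; exists (dH, db) => //.
  by split; rewrite //= uE tu.
rewrite lee_fin /error_ratio /= uE tu ler_pdivrMr // => ub.
rewrite ler_distl -scalemxAr (is_normZ hgamma) gtr0_norm // => /andP[lb _].
rewrite -(ler_pM2l a0) mulrCA (_ : a * tau v = eps); last first.
  by rewrite /a divfK // gt_eqF.
by rewrite mulrDl; lra.
Qed.

End Perturbation.

Lemma cvg_at_right_linear_gap (R : realType) (f : R -> \bar R) (K C delta : R) :
  0 < delta ->
  (forall e, 0 < e <= delta -> ((K - C * e)%:E <= f e <= (K + C * e)%:E)%E) ->
  (f e @[e --> 0^'+] --> K%:E)%classic.
Proof.
move=> delta0 fK.
have lin (c : R) : ((K + c * e)%:E @[e --> 0^'+] --> K%:E)%classic.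
  apply: cvg_EFin; first by apply: nearW => e.
  rewrite -[X in (_ --> X)%classic]addr0 -[X in (_ --> _ + X)%classic](mulr0 c).
  apply: cvgD; first exact: cvg_cst.
  apply: cvgMr; apply: cvg_at_right_filter; exact: cvg_id.
apply: (squeeze_cvge _ (lin (- C)) (lin C)).
near=> e; rewrite mulNr; apply: fK; apply/andP; split.
  by near: e; exact: nbhs_right_gt.
by near: e; exact: nbhs_right_ltW.
Unshelve. all: by end_near. Qed.

Theorem theorem1 (R : realType) (n m p k : nat)
  (hk : (k <= n + (m + p))%N)
  (H : blocks R n m p) (b : 'cV[R]_(n + (m + p)))
  (hB : dsp_mx H \in unitmx)
  (x : 'cV[R]_n) (y : 'cV[R]_m) (z : 'cV[R]_p)
  (hw : dsp_mx H *m col_mx x (col_mx y z) = b)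
  (L : 'M[R]_(k, n + (m + p)))
  (xi : 'cV[R]_k) (Psi : blocks R n m p) (chi : 'cV[R]_(n + (m + p)))
  (tau : 'cV[R]_(n * n + (n * m + (m * p + (m * m + p * p)))
                 + (n + (m + p))) -> R)
  (gamma : 'cV[R]_k -> R)
  (htau : is_norm tau) (hgamma : is_norm gamma)
  (htau_supp : supp_monotone (col_mx (vec_blocks Psi) chi) tau) :
  partial_unified_cond L xi Psi chi tau gamma H b =
  (induced_norm tau gamma
     (diag_mx (ddagger xi)^T *m L *m invmx (dsp_mx H)
      *m row_mx (Gmx x y z) (- 1%:M)
      *m block_mx (diag_mx (vec_blocks Psi)^T) 0 0 (diag_mx chi^T)))%:E.
Proof.
rewrite -diag_mx_row -tr_col_mx.
have [C _ [delta delta0 bounds]] :=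
  error_sup_first_order hB hw L xi htau hgamma htau_supp.
apply: cvg_lim => //; exact: cvg_at_right_linear_gap delta0 bounds.
Qed.
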